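(* Let $K>0$ and let $P$ be a Borel probability measure on $\mathbb{R}^d$ with $\mathrm{Supp}(P)\subset\overline{B}(0,K)$ such that $P(\partial H(v,c))=0$ and $P(\partial B(x,r))=0$ for all unit vectors $v\in\mathbb{R}^d$, $x\in\mathbb{R}^d$, $c\in\mathbb{R}$, $r\ge0$. Then for all $h\in(0,1]$, the set of local means $\mathcal{M}_h(P)$ is convex.
   Context: $\mathbb{R}^d$ carries the Euclidean norm; $B(x,r)$ and $\overline{B}(x,r)$ are the open and closed balls. For a unit vector $v$ and $c\in\mathbb{R}$, $H(v,c)=\{x:\langle x,v\rangle>c\}$. Conventions: $\inf\emptyset=+\infty$, $\sup\emptyset=-\infty$, $B(x,+\infty)=H(v,-\infty)=\mathbb{R}^d$. $\delta_{P,h}(x)=\inf\{r>0: P(\overline{B}(x,r))>h\}$; $c_{P,h}(v)=\sup\{c\in\mathbb{R}: P(H(v,c))>h\}$. Let $\overline{\mathbb{R}}_d=\mathbb{R}^d\cup\{v_\infty: \|v\|=1\}$, where $v_\infty$ is a point at infinity in direction $v$. For $x\in\mathbb{R}^d$, $\mathcal{P}_{x,h}(P)$ is the set of probability measures $P_{x,h}=\frac1h Q$ with $Q$ a sub-measure of $P$ of total mass $h$, coinciding with $P$ on $B(x,\delta_{P,h}(x))$ and supported on $\overline{B}(x,\delta_{P,h}(x))$. For $x=v_\infty$, $\mathcal{P}_{v_\infty,h}(P)$ is defined in the same way with $H(v,c_{P,h}(v))$ and its closure replacing the open and closed ball. For the measures considered here these sets are singletons $\{P_{x,h}\}$. $m(P_{x,h})=\int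 u\,dP_{x,h}(u)$, and $\mathcal{M}_h(P)=\{m(P_{x,h}): x\in\overline{\mathbb{R}}_d\}$. *)

(* Defs.v *)
From HB Require Import structures.
From mathcomp Require Import all_boot all_order all_algebra.
From mathcomp Require Import all_classical all_reals all_analysis.

Set Implicit Arguments.
Unset Strict Implicit.
Unset Printing Implicit Defensive.

Import Order.TTheory GRing.Theory Num.Theory.
Import numFieldNormedType.Exports.

Local Open Scope classical_set_scope.
Local Open Scope ring_scope.

(* The library norm on 'rV[R]_d is the sup norm, so the Euclidean one is
   introduced here; both induce the same topology, hence [open], [closure]
   and the Borel sigma-algebra below are the usual ones on R^d. *)
Definition dotv (R : realType) (d : nat) (u v : 'rV[R]_d) : R :=
  \sum_(i < d) u 0 i * v 0 i.

Definition enorm (R : realType) (d : nat) (u : 'rV[R]_d) : R :=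
  Num.sqrt (dotv u u).

Definition borelRd (R : realType) (d : nat) :=
  g_sigma_algebraType (@open 'rV[R]_d).

(* The radius [r] and the level [c] are extended reals, so that
   [oball x +oo] and [halfspace v -oo] are the whole space. *)
Definition oball (R : realType) (d : nat) (x : 'rV[R]_d) (r : \bar R) :
    set 'rV[R]_d :=
  [set y | ((enorm (y - x))%:E < r)%E].

Definition cball (R : realType) (d : nat) (x : 'rV[R]_d) (r : \bar R) :
    set 'rV[R]_d :=
  [set y | ((enorm (y - x))%:E <= r)%E].

Definition halfspace (R : realType) (d : nat) (v : 'rV[R]_d) (c : \bar R) :
    set 'rV[R]_d :=
  [set y | (c < (dotv y v)%:E)%E].

(* [oball x 0] is empty and so is its boundary; when 0 < d, a measure that does
   not charge the hyperplanes [boundary (halfspace v c)] has no atom anyway. *)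
Definition boundary (T : topologicalType) (A : set T) : set T :=
  closure A `\` interior A.

Definition supp (R : realType) (d : nat)
    (mu : {measure set (borelRd R d) -> \bar R}) : set 'rV[R]_d :=
  [set x | forall U : set 'rV[R]_d, open U -> U x -> (0 < mu U)%E].

Section local_means.
Variables (R : realType) (d : nat).
Variables (P : probability (borelRd R d) R) (h : R).

Definition delta (x : 'rV[R]_d) : \bar R :=
  ereal_inf [set r%:E | r in [set r : R | 0 < r /\ (h%:E < P (cball x r%:E))%E]].

Definition level (v : 'rV[R]_d) : \bar R :=
  ereal_sup [set c%:E | c in [set c : R | (h%:E < P (halfspace v c%:E))%E]].

Definition normalized_submeasures (B C : set 'rV[R]_d) :
    set (probability (borelRd R d) R) :=
  [set mu | exists Q : {measure set (borelRd R d) -> \bar R},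
    [/\ forall A : set (borelRd R d), measurable A -> (Q A <= P A)%E,
        Q setT = h%:E,
        forall A : set (borelRd R d), measurable A -> A `<=` B -> Q A = P A,
        supp Q `<=` C
      & forall A : set (borelRd R d), measurable A ->
          mu A = ((h^-1)%:E * Q A)%E]].

End local_means.

(* [Infty v _] is the point at infinity in the direction [v]. *)
Inductive extRd (R : realType) (d : nat) : Type :=
| Fin of 'rV[R]_d
| Infty (v : 'rV[R]_d) of enorm v = 1.

Definition local_measures (R : realType) (d : nat)
    (P : probability (borelRd R d) R) (h : R) (x : extRd R d) :
    set (probability (borelRd R d) R) :=
  match x with
  | Fin x => normalized_submeasures P h
               (oball x (delta P h x)) (cball x (delta P h x))
  | @Infty _ _ v _ => normalized_submeasures P h
               (halfspace v (level P h v)) (closure (halfspace v (level P h v)))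
  end.

Definition mean (R : realType) (d : nat)
    (mu : probability (borelRd R d) R) : 'rV[R]_d :=
  \row_(i < d) (\int[mu]_(u in setT) (u : 'rV[R]_d) 0 i).

Definition local_means (R : realType) (d : nat)
    (P : probability (borelRd R d) R) (h : R) : set 'rV[R]_d :=
  [set m | exists x : extRd R d, exists2 mu, local_measures P h x mu & mean mu = m].

(* Main.v *)
(* A local measure is a probability [mu] with [h * mu <= P]; the means of all
   such [mu] form a convex set, so it suffices to realize a convex combination
   [m] of two local means.  For [x] in R^d let
     F(x) = min over mu of  int |u|^2 dmu - 2 <mean mu - m, x>.
   The minimum is attained exactly at the local measure of the ball centered at
   [x] (bathtub principle), so [F] is a concave function whose gradient at [x] is
   twice [m - mean(P_{x,h})].  If the maximum of [F] over some cube [-n, n]^d is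
   attained in the interior, then [m] is the mean of a ball.  Otherwise the
   rescaled maximizers accumulate at a direction [v] such that [m] maximizes
   <., v> among all means; then so do the two local means of which [m] is a
   combination.  By the bathtub principle both of their measures are the
   normalized restriction of [P] to one halfspace, hence the two means are
   equal to [m]. *)
Require Import Defs.
From mathcomp Require Import all_boot all_order all_algebra.
From mathcomp Require Import finmap.
From mathcomp Require Import all_classical all_reals all_analysis.
From mathcomp Require Import measurable_realfun ring lra.

Set Implicit Arguments.
Unset Strict Implicit.
Unset Printing Implicit Defensive.

Import Order.TTheory GRing.Theory Num.Theory.
Import numFieldNormedType.Exports.

Local Open Scope classical_set_scope.
Local Open Scope ring_scope.

Lemma exists_natSinv_lt (R : realType) (e : R) :
  0 < e -> exists n : nat, n.+1%:R^-1 < e.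
Proof.
move=> e0; have [n _ /(_ n (leqnn n))] := near_infty_natSinv_lt (PosNum e0).
by exists n.
Qed.

(** * Sub-measures and quantiles *)

Section submeasures.
Context {disp : measure_display} {T : measurableType disp} {R : realType}.
Implicit Types P mu nu : probability T R.

(* [h * mu <= P], i.e. [h * mu] is a sub-measure of [P] of mass [h]. *)
Definition dominated P (h : R) mu :=
  forall A, measurable A -> (h%:E * mu A <= P A)%E.

Lemma prob_bigcup_le P (F : (set T)^nat) (a : \bar R) :
  (forall n, measurable (F n)) -> nondecreasing_seq F ->
  (forall n, P (F n) <= a)%E -> (P (\bigcup_n F n) <= a)%E.
Proof.
move=> mF ndF Fa.
have cF := nondecreasing_cvg_mu (mu := P) mF (bigcupT_measurable _ mF) ndF.
rewrite -(cvg_lim _ cF)//; apply: lime_le; first by apply/cvg_ex; eexists; exact: cF.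
by apply: nearW => n /=.
Qed.

Lemma prob_bigcap_ge P (F : (set T)^nat) (a : \bar R) :
  (forall n, measurable (F n)) -> nonincreasing_seq F ->
  (forall n, a <= P (F n))%E -> (a <= P (\bigcap_n F n))%E.
Proof.
move=> mF niF Fa.
have F0 : (P (F 0%N) < +oo)%E by rewrite ltey_eq fin_num_measure.
have cF := nonincreasing_cvg_mu F0 mF (bigcapT_measurable mF) niF.
rewrite -(cvg_lim _ cF)//; apply: lime_ge; first by apply/cvg_ex; eexists; exact: cF.
by apply: nearW => n /=.
Qed.

(** * Quantiles of a measurable function *)

Section quantile.
Variables (P : probability T R) (h : R) (psi : T -> R).
Hypotheses (h0 : 0 < h) (h1 : h < 1) (mpsi : measurable_fun setT psi).

(** The strict inequality is the one in the definition of [delta]; when [psi] is the distance to a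
    point, [inf S] is the radius of the local ball. *)
Let S := [set s : R | (h%:E < P [set u | (psi u <= s)%R])%E].

Lemma measurable_sublevel s : measurable [set u | psi u <= s].
Proof.
have -> : [set u | psi u <= s] = setT `&` psi @^-1` `]-oo, s].
  by rewrite setTI; apply/seteqP; split => u /=; rewrite in_itv.
exact: mpsi.
Qed.

Lemma measurable_ssublevel s : measurable [set u | psi u < s].
Proof.
have -> : [set u | psi u < s] = setT `&` psi @^-1` `]-oo, s[.
  by rewrite setTI; apply/seteqP; split => u /=; rewrite in_itv.
exact: mpsi.
Qed.

Lemma measurable_level s : measurable [set u | psi u = s].
Proof.
have -> : [set u | psi u = s] = setT `&` psi @^-1` [set s] by rewrite setTI.
exact: mpsi.
Qed.

(** The sublevel sets at integers increase to the whole space, whose mass 1 exceeds [h]. *)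
Lemma quantile_nonempty : S !=set0.
Proof.
apply: contrapT => S0; suff : (P setT <= h%:E)%E.
  by rewrite probability_setT lee_fin leNgt h1.
have -> : setT = \bigcup_n [set u | psi u <= n%:R].
  apply/seteqP; split => // u _; exists (Num.truncn `|psi u|).+1 => //=.
  by rewrite (le_trans (ler_norm _))// ltW// truncnS_gt.
apply: prob_bigcup_le => [n|m n mn|n]; first exact: measurable_sublevel.
  by apply/subsetPset => u /= /le_trans; apply; rewrite ler_nat.
by rewrite leNgt; apply/negP => hn; apply: S0; exists n%:R.
Qed.

(** The sublevel sets at [- n] decrease to the empty set, so one of them has mass below [h], and
    that [- n] bounds [S] from below. *)
Lemma quantile_lbound : has_lbound S.
Proof.
have [[n hn]|H] := pselect (exists n : nat, P [set u | (psi u <= - n%:R)%R] < h%:E)%E.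
  exists (- n%:R) => s hs; rewrite leNgt; apply/negP => sn.
  move: hs; rewrite /S/= ltNge => /negP; apply; apply: ltW; apply: le_lt_trans hn.
  apply: le_measure; rewrite ?inE; [exact: measurable_sublevel..|].
  by move=> u /= /le_trans; apply; exact: ltW.
suff : (h%:E <= P set0)%E by rewrite measure0 lee_fin leNgt h0.
have -> : set0 = \bigcap_n [set u | psi u <= - n%:R].
  apply/seteqP; split => // u /(_ (Num.truncn `|psi u|).+1 I) /=.
  by rewrite lerNr leNgt -normrN (le_lt_trans (ler_norm _))// truncnS_gt.
apply: prob_bigcap_ge => [n|m n mn|n]; first exact: measurable_sublevel.
  by apply/subsetPset => u /= /le_trans; apply; rewrite lerN2 ler_nat.
by rewrite leNgt; apply/negP => hn; apply: H; exists n.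
Qed.

Lemma ssublevelE s : P [set u | psi u = s] = 0%E ->
  P [set u | psi u < s] = P [set u | psi u <= s].
Proof.
move=> P0; have -> : [set u | psi u <= s] = [set u | psi u < s] `|` [set u | psi u = s].
  apply/seteqP; split => u /=; first by rewrite le_eqVlt => /predU1P[]; tauto.
  by case=> [/ltW|->].
rewrite measureU0//; [exact: measurable_ssublevel|exact: measurable_level].
Qed.

(** Levels below [inf S] give mass at most [h], levels above it more than [h]; continuity of [P]
    along monotone sequences pinches the mass once the level set is null. *)
Lemma quantileP (t := inf S) : P [set u | psi u = t] = 0%E ->
  P [set u | psi u < t] = h%:E.
Proof.
move=> Pt; apply/eqP; rewrite eq_le; apply/andP; split.
  have -> : [set u | psi u < t] = \bigcup_n [set u | psi u <= t - n.+1%:R^-1].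
    apply/seteqP; split => u /=.
      rewrite -subr_gt0 => /exists_natSinv_lt[n nt]; exists n => //=.
      by rewrite lerBrDr -lerBrDl ltW.
    by case=> n _ /=/le_lt_trans; apply; rewrite ltrBlDr ltrDl invr_gt0.
  apply: prob_bigcup_le => [n|m n mn|n]; first exact: measurable_sublevel.
    apply/subsetPset => u /= /le_trans; apply; rewrite lerB// lef_pV2 ?posrE//.
    by rewrite ler_nat ltnS.
  rewrite leNgt; apply/negP => /(ge_inf quantile_lbound).
  by rewrite leNgt ltrBlDr ltrDl invr_gt0 ltr0n.
rewrite ssublevelE//.
have -> : [set u | psi u <= t] = \bigcap_n [set u | psi u <= t + n.+1%:R^-1].
  apply/seteqP; split => u /=; first by move=> ut n _ /=; rewrite (le_trans ut)// lerDl.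
  move=> H; rewrite leNgt; apply/negP => ut.
  move: ut; rewrite -subr_gt0 => /exists_natSinv_lt[n].
  by rewrite ltrBrDl ltNge => /negP; apply; apply: H.
apply: prob_bigcap_ge => [n|m n mn|n]; first exact: measurable_sublevel.
  apply/subsetPset => u /= /le_trans; apply; rewrite lerD// lef_pV2 ?posrE//.
  by rewrite ler_nat ltnS.
have [|s hs st] := @inf_adherent R S n.+1%:R^-1 _ (conj quantile_nonempty quantile_lbound).
  by rewrite invr_gt0 ltr0n.
apply: ltW; apply: lt_le_trans hs _; apply: le_measure; rewrite ?inE; [exact: measurable_sublevel..|].
by move=> u /= /le_trans; apply; exact: ltW.
Qed.

End quantile.

End submeasures.

(** * The bathtub principle *)

Section dominated_measures.
Context {disp : measure_display} {T : measurableType disp} {R : realType}.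
Variables (P : probability T R) (h : R).
Hypothesis h0 : 0 < h.
Implicit Types mu nu : probability T R.

Lemma dominated_null mu A : dominated P h mu -> measurable A ->
  P A = 0%E -> mu A = 0%E.
Proof.
move=> muP mA PA; apply/eqP; rewrite -measure_le0.
have := muP _ mA; rewrite PA.
by rewrite -[X in (_ <= X)%E](mule0 h%:E) lee_pmul2l// lte_fin.
Qed.

Lemma probability1C mu B : measurable B -> mu B = 1%E -> mu (~` B) = 0%E.
Proof. by move=> mB muB; rewrite probability_setC// muB subee. Qed.

(** The domination inequalities on [A] and on the rest of [B] add up to an equality on [B], so
    neither is strict. *)
Lemma dominated_eq mu B : dominated P h mu -> measurable B ->
  P B = h%:E -> mu B = 1%E ->
  forall A, measurable A -> A `<=` B -> (h%:E * mu A = P A)%E.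
Proof.
move=> muP mB PB muB A mA AB; apply/eqP; rewrite eq_le muP//=.
have mBA : measurable (B `\` A) by exact: measurableD.
have PE : (P A + P (B `\` A) = h%:E)%E.
  rewrite -measureU//; last by rewrite setDIK.
  by rewrite setDUK.
have muE : (mu A + mu (B `\` A) = 1)%E.
  rewrite -measureU//; last by rewrite setDIK.
  by rewrite setDUK.
have := muP _ mBA; move: PE muE.
rewrite -(fineK (fin_num_measure P _ mA)) -(fineK (fin_num_measure P _ mBA)).
rewrite -(fineK (fin_num_measure mu _ mA)) -(fineK (fin_num_measure mu _ mBA)).
rewrite -!EFinD -!EFinM !lee_fin => -[PE] [muE].
have -> : fine (mu (B `\` A)) = 1 - fine (mu A) by rewrite -muE; ring.
have -> : fine (P (B `\` A)) = h - fine (P A) by rewrite -PE; ring.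
by rewrite mulrBr mulr1; lra.
Qed.

Lemma dominated_restr B : measurable B -> P B = h%:E ->
  exists mu, dominated P h mu /\ mu B = 1%E.
Proof.
(* [mnormalize] falls back to its second argument when the total mass is 0 or infinite; the mass is
   [h] here, so the default never occurs. *)
move=> mB PB; pose nu : probability T R := mnormalize (mrestr P mB) P.
have E A : nu A = (P (A `&` B) * h^-1%:E)%E.
  rewrite /nu/= /mnormalize/= /mrestr setTI PB ifF//.
  by apply/negbTE; rewrite negb_or eqe gt_eqF.
exists nu; split=> [A mA|].
  rewrite E muleC -muleA -EFinM mulVf ?gt_eqF// mule1.
  apply: le_measure; rewrite ?inE//; exact: measurableI.
by rewrite E setIid PB -EFinM divff// gt_eqF.
Qed.

(** Inside [B], [nu] equals [P] divided by [h], the largest measure that domination allows. *)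
Lemma dominated_le_integral mu nu B (f : T -> \bar R) :
  dominated P h mu -> dominated P h nu -> measurable B ->
  P B = h%:E -> nu B = 1%E -> measurable_fun setT f -> (forall x, 0 <= f x)%E ->
  (\int[mu]_(x in B) f x <= \int[nu]_(x in B) f x)%E.
Proof.
move=> muP nuP mB PB nuB mf f0.
have hi : 0 <= h^-1 by rewrite invr_ge0 ltW.
pose k : {nonneg R} := NngNum hi.
rewrite [leRHS](eq_measure_integral (mscale k P)); last first.
  move=> A mA AB /=; rewrite /mscale/= -(dominated_eq nuP mB PB nuB mA AB).
  by rewrite muleA -EFinM mulVf ?gt_eqF// mul1e.
apply: ge0_le_measure_integral => // A mA.
rewrite /= /mscale/= -[leLHS]mul1e -(mulVf (lt0r_neq0 h0)) EFinM -muleA.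
by rewrite lee_pmul2l ?lte_fin ?invr_gt0//; exact: muP.
Qed.

(** After subtracting [t] the integrand is negative exactly on [B]. There [nu] has as much mass as
    domination allows, and it has none outside: its negative part integrates to the most, its
    positive part to 0. In the equality case the positive part integrates to 0 under [mu] too, so
    [mu] could leave [B] only through the null level set. *)
Lemma bathtub mu nu (psi : T -> R) (t : R) (B := [set u | psi u < t]) :
  dominated P h mu -> dominated P h nu -> measurable_fun setT psi ->
  mu.-integrable setT (EFin \o psi) -> nu.-integrable setT (EFin \o psi) ->
  P B = h%:E -> nu B = 1%E ->
  \int[nu]_x psi x <= \int[mu]_x psi x /\
  (P [set u | psi u = t] = 0%E -> \int[mu]_x psi x <= \int[nu]_x psi x ->
   mu B = 1%E).
Proof.
move=> muP nuP mpsi imu inu PB nuB.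
have mB : measurable B by exact: measurable_ssublevel.
pose f := EFin \o (fun x => psi x - t).
have mf : measurable_fun setT f.
  by apply/measurable_EFinP; apply: measurable_funB.
have intf m : (m : probability T R).-integrable setT (EFin \o psi) ->
    m.-integrable setT f.
  move=> im; apply: (@integrableB _ _ _ m setT measurableT (EFin \o psi) (EFin \o cst t)) => //.
  exact: finite_measure_integrable_cst.
have fE m : (m : probability T R).-integrable setT (EFin \o psi) ->
    ((\int[m]_x psi x - t)%:E = \int[m]_x f^\+ x - \int[m]_x f^\- x)%E.
  move=> im; rewrite -integralE /Rintegral.
  have fi := integrable_fin_num measurableT im.
  rewrite EFinB fineK//.
  rewrite -[t%:E]mule1 -(@probability_setT _ _ _ m) -integral_cst//.
  rewrite -integralB//; last exact: finite_measure_integrable_cst.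
have mfn : measurable_fun setT (f^\-)%E by exact: measurable_funeneg.
have mfp : measurable_fun setT (f^\+)%E by exact: measurable_funepos.
have f0 u : ~ B u -> (f^\- u = 0)%E.
  rewrite /B/= => /negP; rewrite -leNgt => tu.
  by rewrite funenegE; apply/max_idPr; rewrite /f/= lee_fin oppr_le0 subr_ge0.
have f1 u : B u -> (f^\+ u = 0)%E.
  rewrite /B/= => tu.
  by rewrite funeposE; apply/max_idPr; rewrite /f/= lee_fin subr_le0 ltW.
have BE m : (\int[(m : probability T R)]_x f^\- x = \int[m]_(x in B) f^\- x)%E.
  rewrite [in RHS]integral_mkcond; apply: eq_integral => u _.
  rewrite patchE; case: ifPn => //; rewrite notin_setE; exact: f0.
have nle : (\int[mu]_x f^\- x <= \int[nu]_x f^\- x)%E.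
  by rewrite !BE; apply: dominated_le_integral => // x; rewrite funeneg_ge0.
have pnu : (\int[nu]_x f^\+ x = 0)%E.
  rewrite (@ge0_negligible_integral _ _ _ nu setT (~` B))//; [|exact: measurableC|exact: probability1C].
  by rewrite setTD setCK; apply: integral0_eq => u /f1.
have pmu : (0 <= \int[mu]_x f^\+ x)%E by apply: integral_ge0 => x _; rewrite funepos_ge0.
have nnu := integrable_neg_fin_num measurableT (intf _ inu).
have nmu := integrable_neg_fin_num measurableT (intf _ imu).
have ppmu := integrable_pos_fin_num measurableT (intf _ imu).
move: (fE _ imu) (fE _ inu) nle pmu.
rewrite pnu -(fineK nnu) -(fineK nmu) -(fineK ppmu).
(* [a] and [b] are the integrals of the positive and negative parts under [mu], and [c] is that of
   the negative part under [nu]. *)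
set a := fine _; set b := fine _; set c := fine _.
rewrite -!EFinB !lee_fin => -[emu] [enu] ba a0; split; first lra.
move=> Pt le; have az : a = 0 by lra.
suff muCB : mu (~` B) = 0%E.
  by rewrite -[B]setCK probability_setC ?muCB ?sube0//; exact: measurableC.
have : ae_eq mu setT (f^\+)%E (cst 0%E).
  apply/(ae_eq_integral_abs mu measurableT mfp).
  rewrite -[RHS]/(0%:E) -az /a fineK//; apply: eq_integral => x _.
  by rewrite gee0_abs// funepos_ge0.
move=> [N [mN N0 HN]].
have : mu (N `|` [set u | psi u = t]) = 0%E.
  rewrite measureU0//; [exact: measurable_level|].
  by apply: dominated_null => //; exact: measurable_level.
move=> H; apply/eqP; rewrite -measure_le0 -H; apply: le_measure; rewrite ?inE.
- exact: measurableC.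
- by apply: measurableU => //; exact: measurable_level.
move=> u /negP; rewrite -leNgt le_eqVlt => /predU1P[->|tu]; [by right|left].
apply: HN => /(_ I) /=; rewrite funeposE max_l; last by rewrite /f/= lee_fin subr_ge0 ltW.
by case=> /eqP; rewrite subr_eq0 => /eqP E; rewrite E ltxx in tu.
Qed.

(** With [C] added, the integrand takes values between 0 and [2 * C]: on [B] the measure [nu]
    dominates, and off [B] the upper bound is used. This controls how means vary with the ball. *)
Lemma dominated_Rintegral_le mu nu B (g : T -> R) (C : R) :
  dominated P h mu -> dominated P h nu -> measurable B ->
  P B = h%:E -> nu B = 1%E -> measurable_fun setT g -> (forall x, `|g x| <= C) ->
  \int[mu]_x g x <= \int[nu]_x g x + 2 * C * fine (mu (~` B)).
Proof.
move=> muP nuP mB PB nuB mg gC.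
pose f := EFin \o (fun x => g x + C).
have mf : measurable_fun setT f.
  by apply/measurable_EFinP; apply: measurable_funD.
have f0 x : (0 <= f x)%E by rewrite /f/= lee_fin; have := gC x; rewrite ler_norml; lra.
have f2 x : (f x <= (2 * C)%:E)%E by rewrite /f/= lee_fin; have := gC x; rewrite ler_norml; lra.
have ig m : (m : probability T R).-integrable setT (EFin \o g).
  apply: measurable_bounded_integrable => //.
    by rewrite (le_lt_trans (probability_le1 _ _))// ltry.
  exists C; split; first exact: num_real.
  by move=> x Cx y _ /=; rewrite (le_trans (gC y))// ltW.
have fE m : ((\int[(m : probability T R)]_x g x + C)%:E = \int[m]_x f x)%E.
  have fi := integrable_fin_num measurableT (ig m).
  rewrite EFinD fineK//.
  rewrite -[C%:E]mule1 -(@probability_setT _ _ _ m) -integral_cst//.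
  by rewrite -integralD//; [exact: ig|exact: finite_measure_integrable_cst].
suff : (\int[mu]_x f x <= \int[nu]_x f x + (2 * C * fine (mu (~` B)))%:E)%E.
  by rewrite -(fE mu) -(fE nu) -EFinD lee_fin; lra.
rewrite -(setvU B) setUC ge0_integral_setU//; last 3 first.
- exact: measurableC.
- by rewrite setUv.
- by apply/disj_setPCl.
apply: leeD.
  rewrite setUv; apply: (@le_trans _ _ (\int[nu]_(x in B) f x)%E).
    exact: dominated_le_integral.
  exact: ge0_subset_integral.
rewrite EFinM fineK; last by apply: fin_num_measure; exact: measurableC.
rewrite -integral_cst; last exact: measurableC.
apply: ge0_le_integral => //.
- exact: measurableC.
- exact: measurable_funTS.
Qed.

End dominated_measures.

(** * Euclidean geometry of row vectors *)

Section euclidean.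
Context {R : realType} {d : nat}.
Implicit Types u v w x y : 'rV[R]_d.

Lemma dotvC u v : dotv u v = dotv v u.
Proof. by apply: eq_bigr => i _; rewrite mulrC. Qed.

Lemma dotvDl u v w : dotv (u + v) w = dotv u w + dotv v w.
Proof. by rewrite -big_split; apply: eq_bigr => i _; rewrite !mxE mulrDl. Qed.

Lemma dotvZl a u w : dotv (a *: u) w = a * dotv u w.
Proof. by rewrite mulr_sumr; apply: eq_bigr => i _; rewrite !mxE mulrA. Qed.

Lemma dotvNl u w : dotv (- u) w = - dotv u w.
Proof. by rewrite -scaleN1r dotvZl mulN1r. Qed.

Lemma dotvDr u v w : dotv w (u + v) = dotv w u + dotv w v.
Proof. by rewrite dotvC dotvDl !(dotvC w). Qed.

Lemma dotvZr a u w : dotv w (a *: u) = a * dotv w u.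
Proof. by rewrite dotvC dotvZl dotvC. Qed.

Lemma dotvNr u w : dotv w (- u) = - dotv w u.
Proof. by rewrite dotvC dotvNl dotvC. Qed.

Lemma dotv0 u : dotv u 0 = 0.
Proof. by rewrite /dotv big1// => i _; rewrite mxE mulr0. Qed.

Definition dotvE := (dotvDl, dotvDr, dotvNl, dotvNr, dotvZl, dotvZr).

Lemma dotv_ge0 u : 0 <= dotv u u.
Proof. by apply: sumr_ge0 => i _; rewrite -expr2 sqr_ge0. Qed.

Lemma dotv_eq0 u : (dotv u u == 0) = (u == 0).
Proof.
apply/eqP/eqP => [H|->]; last exact: dotv0.
apply/rowP => i; rewrite mxE.
have sq0 j : true -> 0 <= u 0 j * u 0 j by rewrite -expr2 sqr_ge0.
by apply/eqP; rewrite -sqrf_eq0 expr2 (psumr_eq0P sq0 H).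
Qed.

Lemma sqr_enorm u : enorm u ^+ 2 = dotv u u.
Proof. by rewrite sqr_sqrtr// dotv_ge0. Qed.

Lemma enorm_ge0 u : 0 <= enorm u.
Proof. exact: sqrtr_ge0. Qed.

Lemma enorm_eq0 u : (enorm u == 0) = (u == 0).
Proof. by rewrite -dotv_eq0 -sqr_enorm sqrf_eq0. Qed.

Lemma enormZ a u : enorm (a *: u) = `|a| * enorm u.
Proof.
by rewrite /enorm !dotvE mulrA -expr2 sqrtrM ?sqr_ge0// sqrtr_sqr.
Qed.

Lemma enormN u : enorm (- u) = enorm u.
Proof. by rewrite /enorm !dotvE opprK. Qed.

Lemma enormBC u v : enorm (u - v) = enorm (v - u).
Proof. by rewrite -enormN opprB. Qed.

(** Expand the squared norm of [enorm v *: u - enorm u *: v] and divide by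
    [2 * (enorm u * enorm v)]. *)
Lemma cauchy_schwarz u v : dotv u v <= enorm u * enorm v.
Proof.
have [->|v0] := eqVneq v 0; first by rewrite dotv0 mulr_ge0 ?enorm_ge0.
have nv : 0 < enorm v by rewrite lt_neqAle eq_sym enorm_eq0 v0 enorm_ge0.
have [->|u0] := eqVneq u 0; first by rewrite dotvC dotv0 mulr_ge0 ?enorm_ge0.
have nu : 0 < enorm u by rewrite lt_neqAle eq_sym enorm_eq0 u0 enorm_ge0.
have := dotv_ge0 (enorm v *: u - enorm u *: v).
rewrite !dotvE (dotvC v u) -!sqr_enorm => H.
have {H} : 0 <= 2 * (enorm u * enorm v) * (enorm u * enorm v - dotv u v) by lra.
by rewrite pmulr_rge0 ?subr_ge0// mulr_gt0// mulr_gt0.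
Qed.

Lemma enorm_triangle u v : enorm (u + v) <= enorm u + enorm v.
Proof.
rewrite -(@ler_pXn2r _ 2) ?nnegrE ?addr_ge0 ?enorm_ge0//.
rewrite sqr_enorm sqrrD !sqr_enorm !dotvE (dotvC v u).
have := cauchy_schwarz u v; lra.
Qed.

Lemma enorm_dist_triangle x y u : enorm (u - y) <= enorm (u - x) + enorm (x - y).
Proof. by have := enorm_triangle (u - x) (x - y); rewrite addrA subrK. Qed.

Lemma coord_le_enorm u i : `|u 0 i| <= enorm u.
Proof.
rewrite -sqrtr_sqr ler_sqrt ?dotv_ge0// /dotv (bigD1 i)//= -expr2 lerDl.
by apply: sumr_ge0 => j _; rewrite -expr2 sqr_ge0.
Qed.

(** The library norm is the largest absolute value of a coordinate. The comparison turns Euclidean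
    bounds into the boundedness that compactness criteria ask for. *)
Lemma norm_le_enorm u : `|u| <= enorm u.
Proof.
have [->|u0] := eqVneq `|u| 0; first exact: enorm_ge0.
have [[i j] /= E] := mx_norm_neq0 u0.
by rewrite (E : `|u| = _) ord1; exact: coord_le_enorm.
Qed.

Let coord_cvg u i : (fun u : 'rV[R]_d => u 0 i) @ u --> u 0 i.
Proof. exact: coord_continuous. Qed.

Lemma dotv_cont v : continuous (fun u : 'rV[R]_d => dotv u v).
Proof.
apply: continuous_big => [|i _ u]; first exact: add_continuous.
exact: (cvgM (@coord_cvg u i) (cvg_cst (v 0 i))).
Qed.

Lemma sqr_dist_cont x : continuous (fun u => dotv (u - x) (u - x)).
Proof.
apply: continuous_big => [|i _ u]; first exact: add_continuous.
have c : (fun u : 'rV[R]_d => (u - x) 0 i) @ u --> (u - x) 0 i.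
  rewrite [X in X @ _ --> _](_ : _ = (fun u : 'rV[R]_d => u 0 i - x 0 i)); last first.
    by apply/funext => w; rewrite !mxE.
  rewrite !mxE; exact: (cvgB (@coord_cvg u i) (cvg_cst (x 0 i))).
exact: (cvgM c c).
Qed.

Lemma enorm_cont x : continuous (fun u : 'rV[R]_d => enorm (u - x)).
Proof.
move=> u; apply: (@continuous_comp _ _ _ (fun u => dotv (u - x) (u - x)) Num.sqrt).
  exact: sqr_dist_cont.
exact: sqrt_continuous.
Qed.

Lemma open_measurable_borel (U : set 'rV[R]_d) :
  open U -> measurable (U : set (borelRd R d)).
Proof. by move=> oU; apply: sub_sigma_algebra. Qed.

Lemma closed_measurable_borel (U : set 'rV[R]_d) :
  closed U -> measurable (U : set (borelRd R d)).
Proof.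
move=> cU; rewrite -(setCK U); apply: measurableC.
by apply: open_measurable_borel; exact: closed_openC.
Qed.

Lemma continuous_measurable_borel (g : 'rV[R]_d -> R) :
  continuous g -> measurable_fun setT (g : borelRd R d -> R).
Proof.
move=> cg; apply: (measurability _ (RGenOpens.measurableE R)).
move=> _ [_ [a [b ->] <-]]; rewrite setTI.
apply: open_measurable_borel; apply: open_comp; last exact: interval_open.
by move=> x _; exact: cg.
Qed.

Lemma measurable_dist x : measurable_fun setT (fun u : borelRd R d => enorm ((u : 'rV[R]_d) - x)).
Proof. by apply: continuous_measurable_borel; exact: enorm_cont. Qed.

End euclidean.
#[local] Hint Resolve measurable_dist : core.

(** * Null sets *)

Section borel_probability.
Context {R : realType} {d : nat}.
Variable P : probability (borelRd R d) R.
Implicit Types u v w x y : 'rV[R]_d.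

(** Serves to place [u] in the closure of a set that contains the beginning of a ray issued from
    [u]. *)
Lemma nbhs_line u w (B : set 'rV[R]_d) : nbhs u B ->
  \forall t \near (0:R)^'+, B (u + t *: w).
Proof.
move=> uB; have c : (fun t : R => u + t *: w) @ (0:R)^'+ --> u + 0 *: w.
  apply: cvg_at_right_filter.
  exact: (cvgD (cvg_cst u) (@scalel_continuous _ _ w 0)).
by move: c; rewrite scale0r addr0 => /(_ _ uB).
Qed.

Lemma measurable_boundary (A : set 'rV[R]_d) :
  measurable (boundary A : set (borelRd R d)).
Proof.
apply: (@measurableD _ (borelRd R d)).
  by apply: closed_measurable_borel; exact: closed_closure.
by apply: open_measurable_borel; exact: open_interior.
Qed.

Lemma measurable_eq_cont (g : 'rV[R]_d -> R) (c : R) : continuous g ->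
  measurable ([set u | g u = c] : set (borelRd R d)).
Proof. by move=> /continuous_measurable_borel/measurable_level; apply. Qed.

Hypothesis Pv : forall v (c : R), enorm v = 1 ->
  P (boundary (halfspace v c%:E)) = 0%E.

(** A point of the hyperplane is outside the open halfspace but a limit of points pushed into it
    along the unit normal, so it lies on the boundary. *)
Lemma null_hyperplane v (c : R) : v != 0 -> P [set u | dotv u v = c] = 0%E.
Proof.
move=> v0; have nv : 0 < enorm v by rewrite lt_neqAle eq_sym enorm_eq0 v0 enorm_ge0.
pose v' := (enorm v)^-1 *: v.
have v'1 : enorm v' = 1 by rewrite enormZ normfV gtr0_norm// mulVf// gt_eqF.
apply: (@subset_measure0 _ _ _ P _ (boundary (halfspace v' (c / enorm v)%:E))).
- by apply: measurable_eq_cont; exact: dotv_cont.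
- exact: measurable_boundary.
- move=> u /= uc.
have uc' : dotv u v' = c / enorm v by rewrite dotvE uc mulrC.
split; last first.
  by move=> /interior_subset; rewrite /halfspace/= lte_fin uc' ltxx.
move=> B /(nbhs_line v') uB.
near (0:R)^'+ => t; exists (u + t *: v'); split; last by near: t.
rewrite /halfspace/= lte_fin dotvE uc' ltrDl dotvE -sqr_enorm v'1 expr1n mulr1.
by near: t; exact: nbhs_right_gt.
- exact: Pv.
Unshelve. all: by end_near. Qed.

Hypothesis Pb : forall x (r : R), 0 <= r -> P (boundary (oball x r%:E)) = 0%E.
Hypothesis d0 : (0 < d)%N.

(** For a positive radius, a small move towards the centre enters the open ball, so the sphere lies
    in the boundary. *)
Lemma null_sphere x (r : R) : P [set u | enorm (u - x) = r] = 0%E.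
Proof.
have ms : measurable ([set u | enorm (u - x) = r] : set (borelRd R d)).
  by apply: measurable_eq_cont; exact: enorm_cont.
have [r0|r0|r0] := ltgtP r 0.
- rewrite (_ : [set _ | _] = set0) ?measure0//; apply/seteqP; split => // u /= ur.
  by move: r0; rewrite -ur ltNge enorm_ge0.
- apply: (subset_measure0 ms (measurable_boundary (oball x r%:E))); last exact/Pb/ltW.
  move=> u /= ur; split; last first.
    by move=> /interior_subset; rewrite /oball/= lte_fin ur ltxx.
  move=> B /(nbhs_line (x - u)) uB.
  near (0:R)^'+ => t; exists (u + t *: (x - u)); split; last by near: t.
  have -> : (oball x r%:E (u + t *: (x - u))) = (enorm ((1 - t) *: (u - x)) < r) :> Prop.
    by rewrite /oball/= lte_fin; congr (enorm _ < _); apply/rowP => i; rewrite !mxE; ring.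
  have t0 : 0 < t by near: t; exact: nbhs_right_gt.
  have t1 : t < 1 by near: t; exact: nbhs_right_lt.
  rewrite enormZ ur gtr0_norm ?subr_gt0// gtr_pMl//; lra.
(* For radius 0 the ball and its boundary are empty; the point [x] is instead covered by a
   hyperplane with a coordinate normal, which exists because [0 < d]. *)
- pose i : 'I_d := Ordinal d0.
  have e0 : delta_mx 0 i != 0 :> 'rV[R]_d.
    by apply/eqP => /matrixP/(_ 0 i); rewrite !mxE !eqxx => /eqP; rewrite oner_eq0.
  have := null_hyperplane (dotv x (delta_mx 0 i)) e0.
  apply: subset_measure0 => //; first by apply: measurable_eq_cont; exact: dotv_cont.
  by move=> u /= /eqP; rewrite r0 enorm_eq0 subr_eq0 => /eqP ->.
Unshelve. all: by end_near. Qed.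

(** * Nullity of the complement of the support *)

Lemma open_cover_null (C : set 'rV[R]_d) (f : 'rV[R]_d -> set 'rV[R]_d) :
  closed C -> compact C ->
  (forall x, C x -> [/\ open (f x), f x x & P (f x) = 0%E]) -> P C = 0%E.
Proof.
move=> clC; rewrite compact_cover => cC Cf.
have [||D DC CD] := cC _ C f.
- by move=> i /Cf[].
- by move=> x Cx; exists x => //; have [] := Cf _ Cx.
apply/negligibleP; first exact: closed_measurable_borel.
suff : P.-negligible (cover [set` D] f) by exact: negligibleS.
rewrite /cover bigcup_fset big_seq.
apply: (big_ind (fun A : set 'rV[R]_d => P.-negligible A)).
- exact: negligible_set0.
- by move=> A B; exact: negligibleU.
move=> x /DC/set_mem /Cf[ofx _ Pfx].
by apply/negligibleP => //; exact: open_measurable_borel.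
Qed.

(** Each point off the support has a null open neighbourhood. The exterior of the ball is a
    countable union of compact shells, each covered by finitely many of these. *)
Lemma supp_null (K : R) : supp P `<=` cball 0 K%:E ->
  P [set u | K < enorm u] = 0%E.
Proof.
move=> PK.
have cont : continuous (fun u : 'rV[R]_d => enorm u).
  by move=> u; have := @enorm_cont R d 0 u; rewrite /continuous_at; under eq_fun do rewrite subr0; rewrite subr0.
pose C n : set 'rV[R]_d := [set u | K + n.+1%:R^-1 <= enorm u <= n%:R].
have -> : [set u | K < enorm u] = \bigcup_n C n.
  apply/seteqP; split => u /=; last first.
    by move=> [n _ /andP[+ _]]; apply: lt_le_trans; rewrite ltrDl invr_gt0.
  rewrite -subr_gt0 => /exists_natSinv_lt[n nu].
  (* The first index keeps the inner radius of the shell below [enorm u], the second keeps the outer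
     one above it. *)
  exists (maxn n (Num.truncn (enorm u)).+1) => //; apply/andP; split.
    rewrite addrC -lerBrDr (le_trans _ (ltW nu))// lef_pV2 ?posrE//.
    by rewrite ler_nat ltnS leq_maxl.
  by rewrite (le_trans (ltW (truncnS_gt _)))// ler_nat leq_maxr.
have clC n : closed (C n).
  have -> : C n = (fun u : 'rV[R]_d => enorm u) @^-1` `[K + n.+1%:R^-1, n%:R]%classic.
    by apply/seteqP; split => u; rewrite /= in_itv.
  by apply: closed_comp => [u _|]; [exact: cont|exact: itv_closed].
apply/negligibleP; first by apply: bigcupT_measurable => n; exact: closed_measurable_borel.
apply: negligible_bigcup => n; apply/negligibleP; first exact: closed_measurable_borel.
have [f Hf] : {f : 'rV[R]_d -> set 'rV[R]_d & forall x, C n x -> [/\ open (f x), f x x & P (f x) = 0%E]}.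
  apply: (@choice _ _ (fun x U => C n x -> [/\ open U, U x & P U = 0%E])) => x.
  (* [setT] is a default value outside [C n], where nothing is required. *)
  have [Cx|] := pselect (C n x); last by exists setT.
  apply: contrapT => H; suff /PK : supp P x.
    rewrite /cball/= subr0 lee_fin leNgt => /negP; apply.
    by move: Cx => /= /andP[+ _]; apply: lt_le_trans; rewrite ltrDl invr_gt0.
  move=> U oU Ux; rewrite lt_neqAle measure_ge0 andbT eq_sym.
  by apply/eqP => PU; apply: H; exists U.
apply: (@open_cover_null _ f) => //; apply: bounded_closed_compact => //.
exists n%:R; split; first exact: num_real.
move=> M nM u /= /andP[_ un]; rewrite (le_trans (norm_le_enorm _))//.
exact: le_trans un (ltW nM).
Qed.

End borel_probability.

(** * Local measures *)

Section normalized.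
Context {R : realType} {d : nat} (P : probability (borelRd R d) R) (h : R).
Hypothesis h0 : 0 < h.
Implicit Types (mu nu : probability (borelRd R d) R) (B C : set 'rV[R]_d).

Lemma normalized_dominated B C mu :
  normalized_submeasures P h B C mu -> dominated P h mu.
Proof.
move=> [Q [QP _ _ _ muQ]] A mA; rewrite muQ// muleA -EFinM divff ?gt_eqF//.
by rewrite mul1e QP.
Qed.

(** The witness is [h] times [mu]. It agrees with [P] on [B] by [dominated_eq], and its support
    stays in [C] because the complement of [C] is open and null for [mu]. *)
Lemma dominated_normalized B C mu : dominated P h mu ->
  measurable (B : set (borelRd R d)) -> closed C -> B `<=` C ->
  P B = h%:E -> mu B = 1%E -> normalized_submeasures P h B C mu.
Proof.
move=> muP mB clC BC PB muB.
pose k : {nonneg R} := NngNum (ltW h0).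
exists (mscale k mu); split.
- by move=> A mA; exact: muP.
- by rewrite /= /mscale/= probability_setT mule1.
- by move=> A mA AB; rewrite /= /mscale/=; exact: (dominated_eq muP mB PB muB).
- move=> x sx; apply: contrapT => Cx.
  have oC : open (~` C) by exact: closed_openC.
  have := sx _ oC Cx; rewrite /= /mscale/=.
  suff -> : mu (~` C) = 0%E by rewrite mule0 ltxx.
  apply: (@subset_measure0 _ _ _ mu (~` C) (~` B)).
  + exact: open_measurable_borel.
  + exact: measurableC.
  + exact: subsetC.
  + exact: probability1C.
- by move=> A mA; rewrite /= /mscale/= muleA -EFinM mulVf ?gt_eqF// mul1e.
Qed.

Lemma local_measures_dominated x mu : local_measures P h x mu -> dominated P h mu.
Proof. by case: x => [x|v v1]; exact: normalized_dominated. Qed.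

Lemma mean_eq mu nu : (forall A, measurable A -> mu A = nu A) -> mean mu = mean nu.
Proof.
move=> E; apply/rowP => i; rewrite !mxE; congr fine.
by apply: eq_measure_integral => A mA _; exact: E.
Qed.

(** A dominated measure carried by [B] must be the normalized restriction of [P] to [B]. *)
Lemma mean_unique mu nu B : dominated P h mu -> dominated P h nu ->
  measurable (B : set (borelRd R d)) -> P B = h%:E ->
  mu B = 1%E -> nu B = 1%E -> mean mu = mean nu.
Proof.
move=> muP nuP mB PB muB nuB; apply: mean_eq => A mA.
have key (m : probability (borelRd R d) R) : dominated P h m -> m B = 1%E ->
    m A = (h^-1%:E * P (A `&` B))%E.
  move=> mP m1; have mAB : measurable (A `&` B) by exact: measurableI.
  rewrite -(dominated_eq mP mB PB m1 mAB); last by move=> u [].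
  rewrite muleA -EFinM mulVf ?gt_eqF// mul1e.
  have -> : m A = (m (A `\` B) + m (A `&` B))%E by exact: measureDI.
  suff -> : m (A `\` B) = 0%E by rewrite add0e.
  apply: (@subset_measure0 _ _ _ m _ (~` B)).
  + exact: measurableD.
  + exact: measurableC.
  + by move=> u [].
  + exact: probability1C.
by rewrite !key.
Qed.

(** * Balls and halfspaces of mass [h] *)

Hypothesis Pv : forall v (c : R), enorm v = 1 ->
  P (boundary (halfspace v c%:E)) = 0%E.
Hypothesis Pb : forall x (r : R), 0 <= r -> P (boundary (oball x r%:E)) = 0%E.
Hypothesis d0 : (0 < d)%N.
Hypothesis h1 : h < 1.

(** A real-valued form of [delta], to which the quantile lemmas apply directly. *)
Definition rad (x : 'rV[R]_d) : R :=
  inf [set s : R | (h%:E < P [set u | (enorm (u - x) <= s)%R])%E].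

Lemma ball_mass x : P [set u | enorm (u - x) < rad x] = h%:E.
Proof. by apply: quantileP => //; exact: null_sphere. Qed.

Lemma rad_ge0 x : 0 <= rad x.
Proof.
rewrite leNgt; apply/negP => r0; have := ball_mass x.
rewrite (_ : [set _ | _] = set0) ?measure0; last first.
  apply/seteqP; split => // u /= /lt_trans /(_ r0); by rewrite ltNge enorm_ge0.
by move=> [] /esym/eqP; rewrite gt_eqF.
Qed.

(** A closed ball of nonpositive radius lies in the sphere of radius 0, which is null, so both
    infima range over the same radii. *)
Lemma deltaE x : delta P h x = (rad x)%:E.
Proof.
rewrite /delta /rad.
set S := [set s : R | (h%:E < P [set u | (enorm (u - x) <= s)%R])%E].
have -> : [set r : R | 0 < r /\ (h%:E < P (cball x r%:E))%E] = S.
  have E r : cball x r%:E = [set u | enorm (u - x) <= r].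
    by apply/seteqP; split => u; rewrite /cball/= lee_fin.
  apply/seteqP; split => r /=; first by rewrite /S/= E => -[].
  rewrite E => hr; split=> //; rewrite ltNge; apply/negP => r0.
  move: hr; rewrite /S/=; apply/negP; rewrite -leNgt.
  suff -> : P [set u | enorm (u - x) <= r] = 0%E by rewrite lee_fin ltW.
  apply: (@subset_measure0 _ _ _ P _ [set u | enorm (u - x) = 0]).
  + exact: measurable_sublevel.
  + exact: measurable_level.
  + by move=> u /= ur; apply/eqP; rewrite eq_le (le_trans ur r0) enorm_ge0.
  + exact: null_sphere.
by apply: ereal_inf_EFin; [exact: quantile_lbound|exact: quantile_nonempty].
Qed.

(** The closed ball of radius [s] around [x] is contained in the one of radius [s + enorm (x - y)]
    around [y]. *)
Lemma rad_le x y : rad y <= rad x + enorm (x - y).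
Proof.
rewrite -lerBlDr; apply: lb_le_inf.
  by apply: quantile_nonempty.
move=> s hs; rewrite lerBlDr; apply: ge_inf; first exact: quantile_lbound.
apply: lt_le_trans hs _.
apply: (le_measure P (mem_set (measurable_sublevel (measurable_dist x) s))
  (mem_set (measurable_sublevel (measurable_dist y) _))) => u /= us.
by rewrite (le_trans (enorm_dist_triangle x y u))// lerD2r.
Qed.

Lemma measurable_ball x r : measurable ([set u | enorm (u - x) < r] : set (borelRd R d)).
Proof. exact: measurable_ssublevel. Qed.

Lemma ball_local x mu : dominated P h mu ->
  mu [set u | enorm (u - x) < rad x] = 1%E -> local_measures P h (Fin x) mu.
Proof.
move=> muP mu1 /=.
have E : oball x (delta P h x) = [set u | enorm (u - x) < rad x].
  by apply/seteqP; split => u; rewrite /oball deltaE/= lte_fin.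
rewrite E; apply: dominated_normalized => //.
- exact: measurable_ball.
- have -> : cball x (delta P h x) = (fun u : 'rV[R]_d => enorm (u - x)) @^-1` `]-oo, rad x]%classic.
    by apply/seteqP; split => u; rewrite /cball deltaE/= in_itv/= lee_fin.
  by apply: closed_comp => [u _|]; [exact: enorm_cont|exact: interval_closed].
- by move=> u /=; rewrite /cball deltaE/= lee_fin => /ltW.
- exact: ball_mass.
Qed.

(* The halfspace [- dotv u v < cut v] is [halfspace v (level P h v)]. *)
Definition cut (v : 'rV[R]_d) : R :=
  inf [set s : R | (h%:E < P [set u | (- dotv u v <= s)%R])%E].

Lemma dot_opp_cont v : continuous (fun u : 'rV[R]_d => - dotv u v).
Proof.
have -> : (fun u : 'rV[R]_d => - dotv u v) = (fun u => dotv u (- v)).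
  by apply/funext => u; rewrite dotvNr.
exact: dotv_cont.
Qed.

Lemma level_set_null v (c : R) : v != 0 -> P [set u | - dotv u v = c] = 0%E.
Proof.
move=> v0; rewrite -(null_hyperplane Pv (- c) v0); congr (P _).
by apply/seteqP; split => u /=; [move=> <-; rewrite opprK|move=> ->; rewrite opprK].
Qed.

Lemma halfspace_mass v : v != 0 -> P [set u | - dotv u v < cut v] = h%:E.
Proof.
move=> v0; apply: quantileP => //; last exact: level_set_null.
by apply: continuous_measurable_borel; exact: dot_opp_cont.
Qed.

End normalized.

(** * Integrals against boundedly supported measures *)

Section bounded_support.
Context {R : realType} {d : nat} (K : R) (mu : probability (borelRd R d) R).
Hypothesis muK : mu [set u : 'rV[R]_d | K < enorm u] = 0%E.
Implicit Types (g : 'rV[R]_d -> R) (x : 'rV[R]_d).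

Lemma enorm_id_cont : continuous (fun u : 'rV[R]_d => enorm u).
Proof.
move=> u; have := @enorm_cont R d 0 u; rewrite /continuous_at.
by under eq_fun do rewrite subr0; rewrite subr0.
Qed.

Let mN : measurable ([set u : 'rV[R]_d | K < enorm u] : set (borelRd R d)).
Proof.
have -> : [set u : 'rV[R]_d | K < enorm u] = ~` [set u | enorm u <= K].
  by apply/seteqP; split => u /=; rewrite ltNge => /negP.
apply: measurableC; apply: measurable_sublevel.
by apply: continuous_measurable_borel; exact: enorm_id_cont.
Qed.

Lemma continuous_bounded_cball g : continuous g ->
  exists C, 0 <= C /\ forall u, enorm u <= K -> `|g u| <= C.
Proof.
move=> cg; pose C := [set u : 'rV[R]_d | enorm u <= K].
have cC : compact C.
  apply: bounded_closed_compact.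
    exists K; split; first exact: num_real.
    by move=> M KM u /= uK; rewrite (le_trans (norm_le_enorm _))// (le_trans uK)// ltW.
  have -> : C = (fun u : 'rV[R]_d => enorm u) @^-1` `]-oo, K]%classic.
    by apply/seteqP; split => u; rewrite /= in_itv.
  by apply: closed_comp => [u _|]; [exact: enorm_id_cont|exact: interval_closed].
have /compact_bounded[M [_ HM]] := continuous_compact (continuous_subspaceT cg) cC.
(* Any number strictly above [M] is a bound; this one is also nonnegative. *)
exists (`|M| + 1); split; first by rewrite addr_ge0.
move=> u uK; apply: HM; last by exists u.
by rewrite (le_lt_trans (ler_norm _))// ltrDl.
Qed.

(* Means are integrals of unbounded coordinates; clipping changes them only
   outside the support. *)
Definition clip (C a : R) := Num.max (- C) (Num.min C a).

Lemma clip_le C a : 0 <= C -> `|clip C a| <= C.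
Proof.
move=> C0; rewrite /clip ler_norml le_max lexx/= ge_max ge_min lexx/=.
by rewrite andbT; lra.
Qed.

Lemma clip_id C a : `|a| <= C -> clip C a = a.
Proof.
rewrite ler_norml => /andP[aC Ca]; rewrite /clip.
by rewrite min_r// max_r.
Qed.

Lemma measurable_clip C g : continuous g ->
  measurable_fun setT ((fun u => clip C (g u)) : borelRd R d -> R).
Proof.
move=> /continuous_measurable_borel mg; apply: measurable_maxr => //.
exact: measurable_minr.
Qed.

Let aeN (Q : 'rV[R]_d -> Prop) : (forall u, enorm u <= K -> Q u) ->
  {ae mu, forall u : borelRd R d, Q u}.
Proof.
move=> HQ; exists [set u : 'rV[R]_d | K < enorm u]; split => //.
by move=> u /= nQ; rewrite ltNge; apply/negP => /HQ.
Qed.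

Lemma continuous_integrable g : continuous g -> mu.-integrable setT (EFin \o g).
Proof.
move=> cg; have [C [C0 gC]] := continuous_bounded_cball cg.
have mg := continuous_measurable_borel cg.
have mG : measurable_fun setT (EFin \o g : borelRd R d -> \bar R) by exact/measurable_EFinP.
apply/(negligible_integrable mN measurableT mG muK).
apply: measurable_bounded_integrable.
- exact: measurableD.
- by rewrite (le_lt_trans (probability_le1 _ _))// ?ltry//; exact: measurableD.
- exact: measurable_funTS.
- exists C; split; first exact: num_real.
  move=> M CM u /= [_ /negP]; rewrite -leNgt => /gC /le_trans; apply; exact: ltW.
Qed.

(** The integrand changes only on a null set and becomes bounded everywhere, as
    [dominated_Rintegral_le] requires. *)
Lemma Rintegral_clip g C : continuous g -> (forall u, enorm u <= K -> `|g u| <= C) ->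
  \int[mu]_u g u = \int[mu]_u clip C (g u).
Proof.
move=> cg gC; congr fine; apply: ae_eq_integral => //.
- by apply/measurable_EFinP; exact: continuous_measurable_borel.
- by apply/measurable_EFinP; exact: measurable_clip.
- by apply: aeN => u /gC gu _ /=; rewrite clip_id.
Qed.

Lemma Rintegral_const (a : R) : \int[mu]_u a = a.
Proof.
rewrite Rintegral_cst// [X in fine X](_ : _ = 1%E) ?mulr1//.
exact: probability_setT.
Qed.

Lemma Rintegral_le_bound g C : 0 <= C -> continuous g ->
  (forall u, enorm u <= K -> `|g u| <= C) -> `|\int[mu]_u g u| <= C.
Proof.
move=> C0 cg gC; rewrite (Rintegral_clip cg gC).
have ic : mu.-integrable setT (EFin \o (fun u => clip C (g u))).
  apply: measurable_bounded_integrable => //.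
  - by rewrite (le_lt_trans (probability_le1 _ _))// ltry.
  - exact: measurable_clip.
  - exists C; split; first exact: num_real.
    by move=> M CM u _ /=; rewrite (le_trans (clip_le _ C0))// ltW.
rewrite ler_norml -[X in X <= _ <= _]Rintegral_const -[X in _ <= _ <= X]Rintegral_const.
by apply/andP; split; apply: le_Rintegral => //; try exact: finite_measure_integrable_cst;
  move=> u _; have := clip_le (g u) C0; rewrite ler_norml => /andP[].
Qed.

Lemma dotv_mean x : dotv (mean mu) x = \int[mu]_u dotv u x.
Proof.
suff E (r : seq 'I_d) : \sum_(i <- r) (mean mu) 0 i * x 0 i =
    \int[mu]_u (\sum_(i <- r) (u : 'rV[R]_d) 0 i * x 0 i).
  exact: E.
have ccont (i : 'I_d) : continuous (fun u : 'rV[R]_d => u 0 i).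
  by move=> u; exact: coord_continuous.
have ci (i : 'I_d) : continuous (fun u : 'rV[R]_d => u 0 i * x 0 i).
  by move=> u; exact: (cvgM (ccont i u) (cvg_cst (x 0 i))).
elim: r => [|i r IH].
  rewrite big_nil; under eq_Rintegral do rewrite big_nil.
  by rewrite Rintegral_const.
rewrite big_cons IH; under [in RHS]eq_Rintegral do rewrite big_cons.
rewrite RintegralD//.
- by rewrite RintegralZr// ?mxE//; exact: continuous_integrable.
- exact: continuous_integrable.
- apply: continuous_integrable; apply: continuous_big => [|j _]; first exact: add_continuous.
  exact: ci.
Qed.

Definition moment2 := \int[mu]_u dotv (u : 'rV[R]_d) u.

Lemma dotv_self_cont : continuous (fun u : 'rV[R]_d => dotv u u).
Proof.
move=> u; have := @sqr_dist_cont R d 0 u; rewrite /continuous_at.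
by under eq_fun do rewrite subr0; rewrite subr0.
Qed.

Lemma moment2_bound : 0 <= K -> 0 <= moment2 <= K ^+ 2.
Proof.
move=> K0; apply/andP; split; first by apply: Rintegral_ge0 => u _; exact: dotv_ge0.
apply: le_trans (ler_norm _) _; apply: Rintegral_le_bound.
- exact: sqr_ge0.
- exact: dotv_self_cont.
- move=> u uK; rewrite -sqr_enorm ger0_norm ?sqr_ge0//.
  by rewrite ler_pXn2r// nnegrE ?enorm_ge0.
Qed.

Lemma abs_dotv x y : `|dotv x y| <= enorm x * enorm y.
Proof.
rewrite ler_norml cauchy_schwarz andbT lerNl -dotvNl -(enormN x).
exact: cauchy_schwarz.
Qed.

Lemma dotv_mean_bound x : 0 <= K -> `|dotv (mean mu) x| <= K * enorm x.
Proof.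
move=> K0; rewrite dotv_mean; apply: Rintegral_le_bound.
- by rewrite mulr_ge0// enorm_ge0.
- exact: dotv_cont.
- move=> u uK; apply: le_trans (abs_dotv _ _) _.
  by rewrite ler_wpM2r// enorm_ge0.
Qed.

(** Since [dotv x x] does not depend on [mu], minimizing the mean squared distance to [x] over [mu]
    amounts to minimizing the other two terms. *)
Lemma Rintegral_sqr_dist x :
  \int[mu]_u dotv ((u : 'rV[R]_d) - x) (u - x) =
  moment2 - 2 * dotv (mean mu) x + dotv x x.
Proof.
have E u : dotv (u - x) (u - x) = (dotv u u - 2 * dotv u x) + dotv x x.
  by rewrite !dotvE (dotvC x u); ring.
under eq_Rintegral do rewrite E.
have i1 := continuous_integrable dotv_self_cont.
have i2 := continuous_integrable (dotv_cont (v := x)).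
have c3 : continuous (fun u : 'rV[R]_d => 2 * dotv u x).
  move=> u; have cu : (fun u : 'rV[R]_d => dotv u x) @ u --> dotv u x by exact: dotv_cont.
  exact: (cvgM (cvg_cst (2 : R)) cu).
have i3 := continuous_integrable c3.
have c4 : continuous (fun u : 'rV[R]_d => dotv u u - 2 * dotv u x).
  move=> u; have cu : (fun u : 'rV[R]_d => dotv u u) @ u --> dotv u u by exact: dotv_self_cont.
  have cu' : (fun u : 'rV[R]_d => 2 * dotv u x) @ u --> 2 * dotv u x by exact: c3.
  exact: (cvgB cu cu').
have i4 := continuous_integrable c4.
rewrite RintegralD//; last exact: finite_measure_integrable_cst.
rewrite RintegralB// RintegralZl// Rintegral_const.
by rewrite dotv_mean.
Qed.

End bounded_support.

(** * The dual problem *)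

Section variational.
Context {R : realType} {d : nat} (K : R) (P : probability (borelRd R d) R) (h : R).
Hypotheses (K0 : 0 < K) (PK : supp P `<=` cball 0 K%:E).
Hypothesis Pv : forall v (c : R), enorm v = 1 ->
  P (boundary (halfspace v c%:E)) = 0%E.
Hypothesis Pb : forall x (r : R), 0 <= r -> P (boundary (oball x r%:E)) = 0%E.
Hypotheses (d0 : (0 < d)%N) (h0 : 0 < h) (h1 : h < 1).
Implicit Types (mu nu : probability (borelRd R d) R) (u w x y m : 'rV[R]_d).

Let ball x : set (borelRd R d) := [set u | enorm (u - x) < rad P h x].

Let mball x : measurable (ball x). Proof. exact: measurable_ball. Qed.

Let Pball x : P (ball x) = h%:E. Proof. exact: ball_mass. Qed.

Lemma dominated_supp mu : dominated P h mu ->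
  mu [set u : 'rV[R]_d | K < enorm u] = 0%E.
Proof.
move=> muP; apply: (dominated_null h0 muP); last exact: supp_null.
apply: open_measurable_borel.
have -> : [set u : 'rV[R]_d | K < enorm u] =
    (fun u : 'rV[R]_d => enorm u) @^-1` `]K, +oo[%classic.
  by apply/seteqP; split => u; rewrite /= in_itv/= andbT.
by apply: open_comp => [u _|]; [exact: enorm_id_cont|exact: interval_open].
Qed.

(** This is the bathtub principle for the squared distance to [x], whose strict sublevel sets are
    balls. *)
Lemma ball_minimal x mu nu : dominated P h mu -> dominated P h nu ->
  nu (ball x) = 1%E ->
  moment2 nu - 2 * dotv (mean nu) x <= moment2 mu - 2 * dotv (mean mu) x.
Proof.
move=> muP nuP nu1.
have := dominated_supp nuP; have := dominated_supp muP => muK nuK.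
have E : ball x = [set u : 'rV[R]_d | dotv (u - x) (u - x) < rad P h x ^+ 2].
  apply/seteqP; split => u; rewrite /ball/= -sqr_enorm;
    by rewrite ltr_pXn2r// nnegrE ?enorm_ge0 ?rad_ge0.
have cx := sqr_dist_cont (x := x).
have [||+ _] := bathtub (t := rad P h x ^+ 2) h0 muP nuP (continuous_measurable_borel cx)
  (continuous_integrable muK cx) (continuous_integrable nuK cx).
- by rewrite -E.
- by rewrite -E.
by rewrite (Rintegral_sqr_dist muK) (Rintegral_sqr_dist nuK) lerD2r.
Qed.

Lemma measurable_shell x (r s : R) :
  measurable ([set u : 'rV[R]_d | r <= enorm (u - x) <= s] : set (borelRd R d)).
Proof.
have -> : [set u : 'rV[R]_d | r <= enorm (u - x) <= s] =
    setT `&` (fun u : borelRd R d => enorm ((u : 'rV[R]_d) - x)) @^-1` `[r, s]%classic.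
  by rewrite setTI; apply/seteqP; split => u; rewrite /= in_itv.
exact: measurable_dist.
Qed.

(** The closed shells shrink to a null sphere. Denominators start at 2 so that their inverses can
    serve as steps strictly between 0 and 1. *)
Lemma thin_shell x (a e : R) : 0 < e ->
  exists n : nat, (P [set u : 'rV[R]_d | (rad P h x <= enorm (u - x) <= rad P h x + a / n.+2%:R)%R] < e%:E)%E.
Proof.
move=> e0; apply: contrapT => H.
have mS b n := measurable_shell x (rad P h x) (rad P h x + b / n.+2%:R).
(* With the absolute value of [a] the shells decrease in [n] whatever the sign of [a], and they
   contain the original ones. *)
have := @prob_bigcap_ge _ _ _ P _ e%:E (mS `|a|).
have -> : P (\bigcap_n [set u : 'rV[R]_d | rad P h x <= enorm (u - x) <= rad P h x + `|a| / n.+2%:R]) = 0%E.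
  apply: (@subset_measure0 _ _ _ P _ [set u | enorm (u - x) = rad P h x]).
  - by apply: bigcapT_measurable => n; exact: mS.
  - exact: measurable_level.
  - move=> u /= Hu; apply/eqP; rewrite eq_le; apply/andP; split; last first.
      by have /andP[] := Hu 0%N I.
    rewrite leNgt -subr_gt0; apply/negP => gt0.
    have a1 : 0 < `|a| + 1 by rewrite ltr_wpDl.
    have /exists_natSinv_lt[n] : 0 < (enorm (u - x) - rad P h x) / (`|a| + 1) by rewrite divr_gt0.
    rewrite ltr_pdivlMr//; apply/negP; rewrite -leNgt lerBlDl.
    have /andP[_ /le_trans] := Hu n I; apply; rewrite lerD2l mulrC.
    by rewrite ler_pM ?invr_ge0// ?lef_pV2 ?posrE ?ler_nat// lerDl.
  - exact: null_sphere.
rewrite lee_fin leNgt e0 => /(_ _ _)H'; suff : false by [].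
apply: H' => [m n mn|n].
  apply/subsetPset => u /= /andP[-> /le_trans]; apply; rewrite lerD2l ler_wpM2l//.
  by rewrite lef_pV2 ?posrE// ler_nat !ltnS.
rewrite leNgt; apply/negP => Hn; apply: H; exists n; apply: le_lt_trans Hn.
apply: (le_measure P (mem_set (mS a n)) (mem_set (mS `|a| n))) => u /= /andP[-> /le_trans]; apply.
by rewrite lerD2l ler_wpM2r ?invr_ge0// ler_norm.
Qed.

Variable loc : 'rV[R]_d -> probability (borelRd R d) R.
Hypothesis locP : forall x, dominated P h (loc x) /\ loc x (ball x) = 1%E.

(* The concave dual function: an infimum of the affine functions
   [x |-> moment2 mu - 2 * dotv (mean mu - m) x] over the dominated [mu]. *)
Definition dual m x := moment2 (loc x) - 2 * dotv (mean (loc x) - m) x.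

Lemma dual_le m x mu : dominated P h mu ->
  dual m x <= moment2 mu - 2 * dotv (mean mu - m) x.
Proof.
move=> muP; have [lP l1] := locP x; have := ball_minimal muP lP l1.
by rewrite /dual !dotvE; lra.
Qed.

(** Testing the minimum at [x] with [loc y], the minimizer at [y], leaves a term linear in [x - y],
    whose slope is controlled by the bound [K] on means. *)
Lemma dual_lipschitz m x y : dual m x <= dual m y + 2 * (K + enorm m) * enorm (x - y).
Proof.
have [lP _] := locP y.
have := dual_le m x lP; have := dotv_mean_bound (dominated_supp lP) (y - x) (ltW K0).
have := abs_dotv m (y - x); rewrite (enormBC y x) /dual !ler_norml !dotvE.
by move=> /andP[A _] /andP[_ B]; lra.
Qed.

Lemma dual_cont m : continuous (dual m).
Proof.
move=> y; suff : (fun x : 'rV[R]_d => dual m x) @ y --> dual m y by [].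
apply/(@cvgrPdist_lt _ _ _ (nbhs y) (nbhs_filter y)) => e e0.
have c0 : 0 < 2 * (K + enorm m) + 1.
  by rewrite ltr_wpDl// mulr_ge0// addr_ge0 ?enorm_ge0 ?ltW.
have : (fun x => enorm (x - y)) @ y --> enorm (y - y) by exact: enorm_cont.
have -> : enorm (y - y) = 0 by apply/eqP; rewrite enorm_eq0 subrr.
move=> /(@cvgrPdist_lt _ _ _ (nbhs y) (nbhs_filter y))/(_ (e / (2 * (K + enorm m) + 1))).
rewrite divr_gt0// => /(_ isT); apply: filterS => x.
rewrite sub0r normrN ger0_norm ?enorm_ge0// ltr_pdivlMr// => H.
have := dual_lipschitz m x y; have := dual_lipschitz m y x.
rewrite (enormBC y x); have := enorm_ge0 (x - y).
by move=> A B C; rewrite ltr_norml; apply/andP; split; lra.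
Qed.

(* First-order optimality at a maximizer along the direction [w], by
   continuity of [x |-> mean (loc x)]. *)
Lemma dual_first_order m x w :
  (forall t, 0 < t < 1 -> dual m (x + t *: w) <= dual m x) ->
  dotv m w <= dotv (mean (loc x)) w.
Proof.
move=> Hmax.
(* Evaluating at both points with the measure of the shifted ball leaves [t] times the desired
   difference; what remains is to let [t] tend to 0. *)
have step t : 0 < t < 1 -> dotv m w <= dotv (mean (loc (x + t *: w))) w.
  move=> t01; have [lP _] := locP (x + t *: w).
  have := dual_le m x lP; have := Hmax t t01; rewrite /dual !dotvE => A B.
  have : 0 <= t * (dotv (mean (loc (x + t *: w))) w - dotv m w) by lra.
  by case/andP: t01 => t0 _; rewrite pmulr_rge0// subr_ge0.
rewrite leNgt -subr_gt0; apply/negP => gap.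
have [C [C0 HC]] := continuous_bounded_cball K (dotv_cont (v := w)).
pose C' := C + 1; have C'0 : 0 < C' by rewrite /C' ltr_wpDl.
have HC' u : enorm u <= K -> `|dotv u w| <= C'.
  by move=> /HC /le_trans; apply; rewrite lerDl.
(* A shell of mass below this value leaves [loc y] too little mass off [ball x] to make up for the
   gap. *)
have e0 : 0 < h * (dotv m w - dotv (mean (loc x)) w) / (2 * C').
  by rewrite divr_gt0// mulr_gt0.
(* Moving the centre by [t *: w] also changes the radius by at most [t * enorm w], hence the factor
   2. *)
have [n] := thin_shell x (2 * enorm w) e0.
apply/negP; rewrite -leNgt.
set t : R := n.+2%:R^-1; have t01 : 0 < t < 1.
  by rewrite invr_gt0 ltr0n /= invf_lt1 ?ltr1n.
have /andP[t0 _] := t01.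
set y := x + t *: w; have [lP l1] := locP y; have [lPx l1x] := locP x.
have S := step _ t01.
have := dominated_Rintegral_le h0 lP lPx (mball x) (Pball x) l1x
  (measurable_clip C' (dotv_cont (v := w))) (fun u => clip_le (dotv u w) (ltW C'0)).
rewrite -(Rintegral_clip (dominated_supp lP) (dotv_cont (v := w)) HC').
rewrite -(Rintegral_clip (dominated_supp lPx) (dotv_cont (v := w)) HC').
rewrite -(dotv_mean (dominated_supp lP)) -(dotv_mean (dominated_supp lPx)) => L.
have mD : measurable (ball y `\` ball x) by exact: measurableD.
have lyD : (loc y (~` ball x) <= loc y (ball y `\` ball x))%E.
  have -> : ~` ball x = (ball y `\` ball x) `|` (~` ball y `\` ball x).
    by apply/seteqP; split => u /=; [have := EM (ball y u); tauto|tauto].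
  rewrite measureU0//; first by apply: measurableD => //; exact: measurableC.
  apply: (@subset_measure0 _ _ _ (loc y) _ (~` ball y)).
  - by apply: measurableD => //; exact: measurableC.
  - exact: measurableC.
  - by move=> u [].
  - exact: probability1C.
have mN : measurable (~` ball x) by exact: measurableC.
have hP : (h%:E * loc y (~` ball x) <= P (ball y `\` ball x))%E.
  apply: le_trans (lP _ mD); rewrite lee_pmul2l// lte_fin//.
have hP2 : (P (ball y `\` ball x) <= P [set u : 'rV[R]_d | (rad P h x <= enorm (u - x) <= rad P h x + 2 * enorm w / n.+2%:R)%R])%E.
  have yx : enorm (y - x) = enorm w / n.+2%:R.
    by rewrite /y addrC addKr enormZ gtr0_norm// mulrC.
  have yx' : enorm (x - y) = enorm w / n.+2%:R by rewrite enormBC.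
  apply: (le_measure P (mem_set mD) (mem_set (measurable_shell _ _ _))).
  move=> u [/= uy /negP]; rewrite -leNgt => ux; rewrite ux/=.
  apply: le_trans (enorm_dist_triangle y x u) _; rewrite yx.
  apply: le_trans (lerD (ltW uy) (lexx _)) _.
  apply: le_trans (lerD (rad_le P h0 h1 x y) (lexx _)) _; rewrite yx'.
  by rewrite -addrA lerD2l -mulrA mulr_natl mulr2n.
apply: le_trans hP2; apply: le_trans hP.
rewrite -(fineK (fin_num_measure (loc y) _ mN)) -EFinM lee_fin.
rewrite ler_pdivrMr ?mulr_gt0//.
rewrite -mulrA ler_pM2l//; lra.
Qed.

(** The location of maximizers of [dual m] on growing cubes decides: an interior one is a critical
    point, while maximizers always on the boundary yield a supporting hyperplane at [m]. *)
Lemma mean_or_support m :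
  (exists x, mean (loc x) = m) \/
  exists2 v, v != 0 & forall mu, dominated P h mu -> dotv (mean mu) v <= dotv m v.
Proof.
(* The library norm is the sup norm, so these are cubes; their sizes start at 1 so that maximizers
   can be rescaled. *)
pose box (n : nat) := [set x : 'rV[R]_d | `|x| <= n.+1%:R].
have boxC n : compact (box n).
  apply: bounded_closed_compact.
    exists n.+1%:R; split; first exact: num_real.
    by move=> M nM u /= /le_trans; apply; exact: ltW.
  have -> : box n = (fun u : 'rV[R]_d => `|u|) @^-1` `]-oo, n.+1%:R]%classic.
    by apply/seteqP; split => u; rewrite /= in_itv.
  by apply: closed_comp => [u _|]; [exact: norm_continuous|exact: interval_closed].
have /choice[z Hz] n : exists x, box n x /\ forall y, box n y -> dual m y <= dual m x.
  have [|x /set_mem bx Hx] := EVT_max_rV _ (boxC n) (continuous_subspaceT (@dual_cont m)).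
    by exists 0; rewrite /box/= normr0.
  by exists x; split => // y By; apply: Hx; exact: mem_set.
have [[n zn]|zb] := pselect (exists n : nat, `|z n| < n.+1%:R).
  left; exists (z n); have [_ Hzn] := Hz n.
  have dir w : dotv m w <= dotv (mean (loc (z n))) w.
    (* This factor shortens [w] enough to stay in the cube; the added 1 covers [w = 0]. *)
    pose s := (n.+1%:R - `|z n|) / (`|w| + 1).
    have w1 : 0 < `|w| + 1 by rewrite ltr_wpDl.
    have s0 : 0 < s by rewrite divr_gt0// subr_gt0.
    have sw : s * `|w| <= n.+1%:R - `|z n|.
      rewrite /s mulrAC ler_pdivrMr// ler_wpM2l ?lerDl// subr_ge0 ltW//.
    have := @dual_first_order m (z n) (s *: w).
    rewrite !dotvE ler_pM2l//; apply => t /andP[t0 t1]; apply: Hzn; rewrite /box/=.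
    apply: le_trans (ler_normD _ _) _; rewrite -lerBrDl; apply: le_trans sw.
    rewrite normrZ (gtr0_norm t0) normrZ (gtr0_norm s0) ler_piMl ?(ltW t1)//.
    by rewrite mulr_ge0// ltW.
  (* In this direction the inequality says that a squared norm is at most 0. *)
  have := dir (m - mean (loc (z n))); rewrite -subr_le0 -dotvNl -dotvDl => le0.
  have : dotv (m - mean (loc (z n))) (m - mean (loc (z n))) == 0.
    by rewrite eq_le le0 dotv_ge0.
  by rewrite dotv_eq0 subr_eq0 => /eqP ->.
right.
have zn n : `|z n| = n.+1%:R.
  apply/eqP; rewrite eq_le; apply/andP; split; first by have [] := Hz n.
  by rewrite leNgt; apply/negP => zn; apply: zb; exists n.
pose v (n : nat) : 'rV[R]_d := n.+1%:R^-1 *: z n.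
have v1 n : `|v n| = 1.
  by rewrite normrZ zn gtr0_norm ?invr_gt0// mulVf.
have bound n mu : dominated P h mu -> 2 * dotv (mean mu - m) (v n) <= K ^+ 2 / n.+1%:R.
  move=> muP; have [_ Hzn] := Hz n; have [lP l1] := locP (z n).
  (* The segment from [z n] to the origin stays in the cube, so along [z n] the mean of [loc (z n)]
     does not exceed [m]. Minimality of [loc (z n)] against [mu] then costs at most a difference of
     second moments, hence [K ^+ 2]. *)
  have : dotv m (- z n) <= dotv (mean (loc (z n))) (- z n).
    apply: dual_first_order => t /andP[t0 t1]; apply: Hzn; rewrite /box/=.
    rewrite scalerN -[X in `|X - _|]scale1r -scalerBl normrZ zn gtr0_norm ?subr_gt0//.
    by rewrite ger_pMl// lerBlDr lerDl ltW.
  have := ball_minimal muP lP l1.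
  have /andP[B1 B2] := moment2_bound (dominated_supp muP) (ltW K0).
  have /andP[B3 B4] := moment2_bound (dominated_supp lP) (ltW K0).
  rewrite ler_pdivlMr// /v dotvZr mulrA mulrAC -(mulrA 2) mulVf// mulr1 !dotvE.
  by move=> A1 A2; lra.
have sphC : compact [set x : 'rV[R]_d | `|x| = 1].
  apply: bounded_closed_compact.
    exists 1; split; first exact: num_real.
    by move=> M nM u /= ->; exact: ltW.
  have -> : [set x : 'rV[R]_d | `|x| = 1] = (fun u : 'rV[R]_d => `|u|) @^-1` [set 1] by [].
  by apply: closed_comp => [u _|]; [exact: norm_continuous|exact: closed_eq].
have [|w [w1 clw]] := sphC (v @ \oo) _.
  by exists 0%N => // n _ /=; exact: v1.
exists w => [|mu muP].
  by apply/eqP => w0; move: w1; rewrite w0 /= normr0 => /esym/eqP; rewrite oner_eq0.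
rewrite -subr_le0 -dotvNl -dotvDl leNgt; apply/negP => a0.
set a := mean mu - m in a0.
have [n nK] := exists_natSinv_lt (divr_gt0 a0 (exprn_gt0 2 K0)).
have cv : (fun y => dotv y a) @ w --> dotv w a by exact: dotv_cont.
(* Half of the value at [w] suffices, since [bound] controls twice the product; a late term [v k] in
   this neighbourhood contradicts it. *)
have near_w : nbhs w [set y | dotv w a / 2 < dotv y a].
  apply: (cv [set r | dotv w a / 2 < r]); apply: open_nbhs_nbhs; split; first exact: open_gt.
  by rewrite /= ltr_pdivrMr// ltr_pMr ?ltr1n// dotvC.
have tail : (v @ \oo) [set v k | k in [set k : nat | (n <= k)%N]].
  by exists n => // k /= nk; exists k.
have [y [[k /= nk <-] /=]] := clw _ _ tail near_w.
have := bound k _ muP; rewrite -/a (dotvC w) (dotvC (v k)) => B1 B2.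
have B3 : K ^+ 2 / k.+1%:R < dotv a w.
  move: nK; rewrite ltr_pdivlMr ?exprn_gt0// mulrC; apply: le_lt_trans.
  by rewrite ler_wpM2l ?sqr_ge0// lef_pV2 ?posrE// ler_nat ltnS.
have := le_lt_trans B1 B3; apply/negP; rewrite -leNgt ltW//.
by rewrite mulrC -ltr_pdivrMr.
Qed.

End variational.

Theorem proposition8 (R : realType) (d : nat) (K : R)
    (P : probability (borelRd R d) R) :
  0 < K ->
  supp P `<=` cball 0 K%:E ->
  (forall (v : 'rV[R]_d) (c : R), enorm v = 1 ->
     P (boundary (halfspace v c%:E)) = 0%E) ->
  (forall (x : 'rV[R]_d) (r : R), 0 <= r ->
     P (boundary (oball x r%:E)) = 0%E) ->
  forall h : R, 0 < h -> h <= 1 -> convex_set (local_means P h).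
Proof.
(* Both weights may be taken strictly positive, which the equality case at the end relies on. *)
move=> K0 PK Pv Pb h h0 h1; apply/convex_setW => x y xA yA k k0 k1.
have [d0|dp] := posnP d.
  (* In dimension 0 there is only one vector. *)
  suff -> : conv k x y = x by [].
  by move: {Pv Pb PK} P x y xA yA; rewrite d0 => P x y _ _; rewrite (thinmx0 (conv k x y)) (thinmx0 x).
have eqA : x = y -> (conv k x y) \in local_means P h by move=> <-; rewrite convmm.
move: xA yA => /set_mem[a [mu1 /(local_measures_dominated h0) P1 E1]].
move=> /set_mem[b [mu2 /(local_measures_dominated h0) P2 E2]].
have same (B : set (borelRd R d)) : measurable B -> P B = h%:E ->
    mu1 B = 1%E -> mu2 B = 1%E -> (conv k x y) \in local_means P h.
  by move=> mB PB B1 B2; apply: eqA; rewrite -E1 -E2; exact: (mean_unique h0 P1 P2 mB PB B1 B2).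
move: h1; rewrite le_eqVlt => /predU1P[h1|h1].
  (* For [h = 1] every dominated measure is carried by the whole space, of mass [h]. *)
  by apply: (same setT); rewrite ?probability_setT// h1.
have /choice[loc locP] z : exists mu, dominated P h mu /\
    mu [set u : 'rV[R]_d | enorm (u - z) < rad P h z] = 1%E.
  by apply: dominated_restr => //; [exact: measurable_ball|exact: ball_mass].
have [[z zm]|[v v0 Hv]] := mean_or_support K0 PK Pv Pb dp h0 h1 locP (conv k x y).
  have [lP l1] := locP z.
  by apply/mem_set; exists (Fin z); exists (loc z) => //; exact: ball_local.
(* The sign is reversed because the bathtub principle minimizes, whereas [m] maximizes the product
   with [v]. *)
pose B : set (borelRd R d) := [set u | - dotv u v < cut P h v].
have cv := dot_opp_cont (v := v).
have mB : measurable B.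
  by apply: measurable_ssublevel; exact: continuous_measurable_borel.
have PB : P B = h%:E by exact: halfspace_mass.
have [nu [nuP nuB]] := dominated_restr h0 mB PB.
have supp0 mu := @dominated_supp R d K P h PK h0 mu.
have meanN mu : dominated P h mu -> \int[mu]_u (- dotv (u : 'rV[R]_d) v) = - dotv (mean mu) v.
  move=> muP; rewrite -dotvNr (dotv_mean (supp0 _ muP)).
  by apply: eq_Rintegral => u _; rewrite dotvNr.
have ext mu : dominated P h mu -> dotv (mean mu) v <= dotv (mean nu) v /\
    (dotv (mean nu) v <= dotv (mean mu) v -> mu B = 1%E).
  move=> muP.
  have := bathtub h0 muP nuP (continuous_measurable_borel cv)
    (continuous_integrable (supp0 _ muP) cv) (continuous_integrable (supp0 _ nuP) cv) PB nuB.
  rewrite !meanN// !lerN2 => -[A1 A2]; split => // A3; apply: A2 => //.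
  exact: level_set_null.
have [A1 A2] := ext _ P1; have [A3 A4] := ext _ P2.
(* The average of the products of [x] and [y] with [v] reaches that of [mean nu], which bounds each
   of them, so both reach it. *)
have := Hv _ nuP.
have -> : dotv (conv k x y) v = k%:num * dotv x v + (1 - k%:num) * dotv y v.
  by rewrite -!dotvZl -dotvDl.
move: A1 A2 A3 A4; rewrite E1 E2 => A1 A2 A3 A4 A5.
have k1' : 0 < 1 - k%:num by rewrite subr_gt0.
apply: (same B) => //.
  apply: A2.
  have : k%:num * dotv x v + (1 - k%:num) * dotv y v <= k%:num * dotv x v + (1 - k%:num) * dotv (mean nu) v.
    by rewrite lerD2l ler_pM2l.
  move=> H; have : k%:num * dotv (mean nu) v <= k%:num * dotv x v by lra.
  by rewrite ler_pM2l.
apply: A4.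
have : k%:num * dotv x v + (1 - k%:num) * dotv y v <= k%:num * dotv (mean nu) v + (1 - k%:num) * dotv y v.
  by rewrite lerD2r ler_pM2l.
move=> H; have : (1 - k%:num) * dotv (mean nu) v <= (1 - k%:num) * dotv y v by lra.
by rewrite ler_pM2l.
Qed.
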